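(* Let $d\ge1$ and let $M$ and $N$ be pointwise finite-dimensional upset-decomposable persistence modules over $\mathbb{R}^d$. Then \[ d_P(M,N)\le d_B(M,N). \]
   Context: Fix a field $k$. $\mathbb{R}^d$ carries the product order; for $\varepsilon\in\mathbb{R}$ and $p\in\mathbb{R}^d$ write $p+\varepsilon:=p+(\varepsilon,\dots,\varepsilon)$. A (persistence) module is a functor $M$ from the poset $\mathbb{R}^d$ to $k$-vector spaces, with spaces $M_p$ and maps $M_{p\to q}$ for $p\le q$; morphisms are natural transformations; direct sums, submodules, images, preimages and quotients are pointwise. $M$ is pointwise finite-dimensional (pfd) if every $M_p$ is finite-dimensional. The shift $M(\varepsilon)$ is $M(\varepsilon)_p=M_{p+\varepsilon}$, $M(\varepsilon)_{p\to q}=M_{p+\varepsilon\to q+\varepsilon}$ (and $f(\varepsilon)$ denotes the shifted morphism); for $\varepsilon\le\delta$, $M_{\varepsilon\to\delta}:M(\varepsilon)\to M(\delta)$ is given at $p$ by $M_{p+\varepsilon\to p+\delta}$. Upset modules: an upset is $U\subseteq\mathbb{R}^d$ such that $p\in U$, $q\ge p$ imply $q\in U$. The associated upset module has $M_p=k$ for $p\in U$, $M_p=0$ otherwise, with $M_{p\to q}=\mathrm{Id}_k$ for $p\in U$, $p\le q$. A module is upset-decomposable if it is isomorphic to a direct sum of upset modules. Barcode: a pfd module $M$ is isomorphic to a direct sum $\bigoplus_{i\in I}M_i$ of nonzero indecomposables, unique up to isomorphism and reindexing; the barcode $B(M)$ is the multiset $\{M_i\}_{i\in I}$ of isomorphism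 classes. Interleavings: $M\sim_\varepsilon N$ ($\varepsilon$-interleaved) means there are morphisms $\varphi:M\to N(\varepsilon)$, $\psi:N\to M(\varepsilon)$ with $\psi(\varepsilon)\circ\varphi=M_{0\to2\varepsilon}$ and $\varphi(\varepsilon)\circ\psi=N_{0\to2\varepsilon}$. Bottleneck distance: an $\varepsilon$-matching between pfd modules $M,N$ is a bijection $\sigma:\bar B(M)\to\bar B(N)$ between sub-multisets $\bar B(M)\subseteq B(M)$, $\bar B(N)\subseteq B(N)$ such that $Q\sim_\varepsilon\sigma(Q)$ for all $Q\in\bar B(M)$ and $Q\sim_\varepsilon 0$ for all unmatched $Q$ in $B(M)$ or $B(N)$. $d_B(M,N)=\inf\{\varepsilon\ge0\mid\text{there is an }\varepsilon\text{-matching between }M\text{ and }N\}\in[0,\infty]$. Pruning: for $\varepsilon\ge 0$ let $I$ be the largest submodule of $M$ such that $f(I)\subseteq M_{0\to2\varepsilon}(I)$ for every morphism $f:M\to M(2\varepsilon)$, and let $K$ be the smallest submodule of $I$ such that $(I_{0\to2\varepsilon})^{-1}(f(K))\subseteq K$ for every morphism $f:M\to M(2\varepsilon)$ (both exist). The $\varepsilon$-pruning of $M$ is $\mathrm{Pru}_\varepsilon(M):=(I/K)(-\varepsilon)$. Refinement: a subquotient of $M$ is a module isomorphic to $I'/K'$ for submodules $K'\subseteq I'\subseteq M$. An $\infty$-refinement of $M\cong\bigoplus_{i\in I}M_i$ (each $M_i$ indecomposable) is a module isomorphic to some $\bigoplus_{i\in I}N_i$ with each $N_i$ a (possibly zero)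 subquotient of $M_i$. Pruning distance: for pfd $M,N$, $d_P(M,N)$ is the infimum in $[0,\infty]$ of all $\varepsilon\ge0$ such that for every $\delta\ge0$, $\mathrm{Pru}_{\varepsilon+\delta}(M)$ is an $\infty$-refinement of $\mathrm{Pru}_\delta(N)$ and $\mathrm{Pru}_{\varepsilon+\delta}(N)$ is an $\infty$-refinement of $\mathrm{Pru}_\delta(M)$. *)

(* Defs.v *)
From HB Require Import structures.
From mathcomp Require Import all_boot all_order all_algebra.
From mathcomp Require Import interval_inference all_classical all_reals ereal.

Set Implicit Arguments.
Unset Strict Implicit.
Unset Printing Implicit Defensive.

Import Order.TTheory GRing.Theory Num.Theory.

Local Open Scope classical_set_scope.
Local Open Scope ring_scope.

Section Subspaces.
Variables (k : fieldType) (V : lmodType k).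

Record subspace := Subspace {
  subspace_set :> V -> Prop;
  subspace0 : subspace_set 0;
  subspaceD : forall x y,
    subspace_set x -> subspace_set y -> subspace_set (x + y);
  subspaceZ : forall (a : k) x, subspace_set x -> subspace_set (a *: x)
}.

Variable W : subspace.

Definition subspace_mem : {pred V} := fun x => `[< W x >].

Lemma subspace_memP x : reflect (W x) (x \in subspace_mem).
Proof. exact: asboolP. Qed.

Lemma subspace_mem_closed : subsemimod_closed subspace_mem.
Proof.
split; first split.
- exact/subspace_memP/subspace0.
- by move=> x y /subspace_memP Wx /subspace_memP Wy;
    apply/subspace_memP/subspaceD.
- by move=> a x /subspace_memP Wx; apply/subspace_memP/subspaceZ.
Qed.

HB.instance Definition _ :=
  GRing.isSubmodClosed.Build k V subspace_mem subspace_mem_closed.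

Definition subspace_type : Type := {x : V | x \in subspace_mem}.
HB.instance Definition _ := SubChoice.on subspace_type.
HB.instance Definition _ := [SubChoice_isSubLmodule of subspace_type by <:].

Definition subspace_elt (x : V) (Wx : W x) : subspace_type :=
  exist _ x (introT (subspace_memP x) Wx).

Definition quot_type : Type := Quotient.quot subspace_mem.
HB.instance Definition _ := GRing.Zmodule.on quot_type.

Definition quot_pi (x : V) : quot_type := (\pi_(Quotient.quot subspace_mem) x)%qT.

Lemma quot_pi_surj (u : quot_type) : exists x, u = quot_pi x.
Proof. by exists (repr u); rewrite /quot_pi reprK. Qed.

Lemma quot_piP x y : quot_pi x = quot_pi y <-> W (x - y).
Proof.
split=> [/eqP|h].
  by rewrite -(Quotient.idealrBE subspace_mem) => /subspace_memP.
by apply/eqP; rewrite -(Quotient.idealrBE subspace_mem); apply/subspace_memP.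
Qed.

Lemma quot_piD x y : quot_pi (x + y) = quot_pi x + quot_pi y.
Proof. exact: (Quotient.pi_add subspace_mem). Qed.

Definition quot_scale (a : k) (u : quot_type) : quot_type :=
  quot_pi (a *: repr u).

Lemma quot_scale_pi a x : quot_scale a (quot_pi x) = quot_pi (a *: x).
Proof.
apply/quot_piP; rewrite -scalerBr; apply/subspaceZ/quot_piP.
by rewrite /quot_pi reprK.
Qed.

Lemma quot_scaleA a b u : quot_scale a (quot_scale b u) = quot_scale (a * b) u.
Proof. by have [x ->] := quot_pi_surj u; rewrite !quot_scale_pi scalerA. Qed.

Lemma quot_scale1 : left_id 1 quot_scale.
Proof.
by move=> u; have [x ->] := quot_pi_surj u; rewrite quot_scale_pi scale1r.
Qed.

Lemma quot_scaleDr : right_distributive quot_scale +%R.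
Proof.
move=> a u v; have [x ->] := quot_pi_surj u; have [y ->] := quot_pi_surj v.
by rewrite -quot_piD !quot_scale_pi scalerDr quot_piD.
Qed.

Lemma quot_scaleDl u : {morph quot_scale^~ u : a b / a + b}.
Proof.
by move=> a b; have [x ->] := quot_pi_surj u; rewrite !quot_scale_pi scalerDl quot_piD.
Qed.

HB.instance Definition _ := GRing.Zmodule_isLmodule.Build k quot_type
  quot_scaleA quot_scale1 quot_scaleDr quot_scaleDl.

Lemma quot_pi_linear : linear quot_pi.
Proof.
by move=> a x y; rewrite quot_piD -quot_scale_pi.
Qed.

HB.instance Definition _ :=
  GRing.isLinear.Build k V quot_type *:%R quot_pi quot_pi_linear.

End Subspaces.

Section SubspaceMaps.
Variables (k : fieldType) (V V' : lmodType k).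
Variables (W : subspace V) (W' : subspace V') (f : {linear V -> V'}).
Hypothesis fW : forall x, W x -> W' (f x).

Definition subspace_map (x : subspace_type W) : subspace_type W' :=
  subspace_elt (fW (elimT (subspace_memP W (val x)) (valP x))).

Lemma subspace_map_linear : linear subspace_map.
Proof. by move=> a x y; apply: val_inj; rewrite /= linearP. Qed.

HB.instance Definition _ := GRing.isLinear.Build k (subspace_type W)
  (subspace_type W') *:%R subspace_map subspace_map_linear.

(* The unused argument [fW] makes the linear structure inferrable. *)
Definition quot_map (_ : forall x, W x -> W' (f x)) (u : quot_type W) :
  quot_type W' := quot_pi W' (f (repr u)).

Lemma quot_map_pi x : quot_map fW (quot_pi W x) = quot_pi W' (f x).
Proof.
apply/quot_piP; rewrite -linearB; apply/fW/quot_piP.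
by rewrite /quot_pi reprK.
Qed.

Lemma quot_map_linear : linear (quot_map fW).
Proof.
move=> a u v; have [x ->] := quot_pi_surj u; have [y ->] := quot_pi_surj v.
by rewrite -linearP !quot_map_pi !linearP.
Qed.

HB.instance Definition _ := GRing.isLinear.Build k (quot_type W)
  (quot_type W') *:%R (quot_map fW) quot_map_linear.

End SubspaceMaps.

Section DirectSum.
Variables (k : fieldType) (I : Type) (V : I -> lmodType k).

Definition dprod : Type := forall i, V i.

HB.instance Definition _ := gen_eqMixin dprod.
HB.instance Definition _ := gen_choiceMixin dprod.

Let zero : dprod := fun=> 0.
Let opp (f : dprod) : dprod := fun i => - f i.
Let add (f g : dprod) : dprod := fun i => f i + g i.
Let scale (a : k) (f : dprod) : dprod := fun i => a *: f i.

Let addA : associative add.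
Proof. by move=> f g h; apply: functional_extensionality_dep => i; exact: addrA. Qed.
Let addC : commutative add.
Proof. by move=> f g; apply: functional_extensionality_dep => i; exact: addrC. Qed.
Let add0 : left_id zero add.
Proof. by move=> f; apply: functional_extensionality_dep => i; exact: add0r. Qed.
Let addN : left_inverse zero opp add.
Proof. by move=> f; apply: functional_extensionality_dep => i; exact: addNr. Qed.

HB.instance Definition _ := GRing.isZmodule.Build dprod addA addC add0 addN.

Let scaleA a b f : scale a (scale b f) = scale (a * b) f.
Proof. by apply: functional_extensionality_dep => i; exact: scalerA. Qed.
Let scale1 : left_id 1 scale.
Proof. by move=> f; apply: functional_extensionality_dep => i; exact: scale1r. Qed.
Let scaleDr : right_distributive scale +%R.
Proof. by move=> a f g; apply: functional_extensionality_dep => i; exact: scalerDr. Qed.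
Let scaleDl f : {morph scale^~ f : a b / a + b}.
Proof. by move=> a b; apply: functional_extensionality_dep => i; exact: scalerDl. Qed.

HB.instance Definition _ := GRing.Zmodule_isLmodule.Build k dprod
  scaleA scale1 scaleDr scaleDl.

Definition finsupp (f : dprod) : Prop := finite_set [set i | f i != 0].

Lemma finsupp0 : finsupp 0.
Proof.
rewrite /finsupp (_ : [set _ | _] = set0); first exact: finite_set0.
by apply/seteqP; split=> i //=; rewrite eqxx.
Qed.

Lemma finsuppD f g : finsupp f -> finsupp g -> finsupp (f + g).
Proof.
move=> Sf Sg; apply: (@sub_finite_set _ _ ([set i | f i != 0] `|` [set i | g i != 0])).
  2: by rewrite finite_setU.
move=> i /= fg0; case: (eqVneq (f i) 0) => [fi0|]; [right|by left].
by apply: contra_neq fg0 => gi0; rewrite /GRing.add /= /add fi0 gi0 addr0.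
Qed.

Lemma finsuppZ a f : finsupp f -> finsupp (a *: f).
Proof.
apply: sub_finite_set => i /=; apply: contra_neq => fi0.
by rewrite /GRing.scale /= /scale fi0 scaler0.
Qed.

Definition dsum_space : subspace dprod := Subspace finsupp0 finsuppD finsuppZ.

Definition dsum_type : lmodType k := subspace_type dsum_space.

End DirectSum.

Section DirectSumMap.
Variables (k : fieldType) (I : Type) (V V' : I -> lmodType k).
Variable f : forall i, {linear V i -> V' i}.

Definition dprod_map (x : dprod V) : dprod V' := fun i => f i (x i).

Lemma dprod_map_linear : linear dprod_map.
Proof.
by move=> a x y; apply: functional_extensionality_dep => i; exact: linearP.
Qed.

HB.instance Definition _ := GRing.isLinear.Build k (dprod V) (dprod V') *:%R
  dprod_map dprod_map_linear.

Lemma dprod_map_finsupp x : dsum_space V x -> dsum_space V' (dprod_map x).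
Proof.
apply: sub_finite_set => i /=; apply: contra_neq => xi0.
by rewrite /dprod_map xi0 linear0.
Qed.

Definition dsum_map : {linear dsum_type V -> dsum_type V'} :=
  subspace_map dprod_map_finsupp.

End DirectSumMap.

Section Modules.
Variables (R : realType) (k : fieldType) (d : nat).

Definition lept (p q : 'rV[R]_d) : Prop := forall i, p 0 i <= q 0 i.

Lemma lept_refl p : lept p p. Proof. by move=> i. Qed.

Lemma lept_trans q p r : lept p q -> lept q r -> lept p r.
Proof. by move=> pq qr i; exact: le_trans (pq i) (qr i). Qed.

Definition addpt (p : 'rV[R]_d) (e : R) : 'rV[R]_d := p + const_mx e.

Lemma lept_add p q e : lept p q -> lept (addpt p e) (addpt q e).
Proof. by move=> pq i; rewrite !mxE lerD2r. Qed.

Lemma lept_addr p (e : {nonneg R}) : lept p (addpt p e%:num).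
Proof. by move=> i; rewrite !mxE lerDl. Qed.

(* [pmod_comp] for all proofs of the inequalities also gives the independence
   of [pmod_map] from the proof of [lept p q]. *)
Record pmod := Pmod {
  pmod_obj :> 'rV[R]_d -> lmodType k;
  pmod_map : forall p q, lept p q -> {linear pmod_obj p -> pmod_obj q};
  pmod_id : forall p (pp : lept p p) x, pmod_map pp x = x;
  pmod_comp : forall p q r (pq : lept p q) (qr : lept q r) (pr : lept p r) x,
    pmod_map qr (pmod_map pq x) = pmod_map pr x
}.

Record pmod_hom (M N : pmod) := PmodHom {
  hom_fun :> forall p, {linear M p -> N p};
  hom_nat : forall p q (pq : lept p q) x,
    hom_fun q (pmod_map M pq x) = pmod_map N pq (hom_fun p x)
}.

Definition pmod_iso (M N : pmod) : Prop :=
  exists (f : pmod_hom M N) (g : pmod_hom N M),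
    (forall p, cancel (f p) (g p)) /\ (forall p, cancel (g p) (f p)).

Definition pfd (M : pmod) : Prop :=
  forall p, exists (n : nat) (f : {linear M p -> 'rV[k]_n}), bijective f.

Definition is_zero_pmod (M : pmod) : Prop := forall p (x : M p), x = 0.

(* The zero module, [k^0] at every point. *)
Definition zero_pmod : pmod.
Proof.
by exists (fun=> 'rV[k]_0) (fun _ _ _ => idfun).
Defined.

Definition pmod_shift (e : R) (M : pmod) : pmod.
Proof.
exists (fun p => M (addpt p e)) (fun p q pq => pmod_map M (lept_add e pq)).
- by move=> p pp x; exact: pmod_id.
- by move=> p q r pq qr pr x; exact: pmod_comp.
Defined.

(* [M_(0 -> e)], with [M(0)] identified with [M]. *)
Definition pmod_trans (M : pmod) (e : {nonneg R}) :
  pmod_hom M (pmod_shift e%:num M).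
Proof.
exists (fun p => pmod_map M (lept_addr p e)).
by move=> p q pq x /=; rewrite !(pmod_comp _ _ (lept_trans pq (lept_addr q e))).
Defined.

Definition pmod_dsum (I : Type) (F : I -> pmod) : pmod.
Proof.
exists (fun p => dsum_type (fun i => F i p))
       (fun p q pq => dsum_map (fun i => pmod_map (F i) pq)).
- move=> p pp x; apply: val_inj; apply: functional_extensionality_dep => i.
  exact: pmod_id.
- move=> p q r pq qr pr x; apply: val_inj.
  by apply: functional_extensionality_dep => i; exact: pmod_comp.
Defined.

Definition pmod_sum2 (M N : pmod) : pmod :=
  pmod_dsum (fun b : bool => if b then M else N).

Definition indecomposable (M : pmod) : Prop :=
  ~ is_zero_pmod M /\
  forall A B, pmod_iso M (pmod_sum2 A B) -> is_zero_pmod A \/ is_zero_pmod B.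

Record submod (M : pmod) := Submod {
  submod_space :> forall p, subspace (M p);
  submod_map : forall p q (pq : lept p q) x,
    submod_space p x -> submod_space q (pmod_map M pq x)
}.

Definition submod_zero M : submod M.
Proof.
unshelve eexists.
  move=> p; exists (fun x => x = 0) => //.
  - by move=> x y -> ->; rewrite addr0.
  - by move=> a x ->; rewrite scaler0.
by move=> p q pq x /= ->; rewrite linear0.
Defined.

Definition submod_sum M (S T : submod M) : submod M.
Proof.
unshelve eexists.
  move=> p; exists (fun x => exists y z, [/\ S p y, T p z & x = y + z]).
  - by exists 0, 0; rewrite addr0; split=> //; exact: subspace0.
  - move=> x x' [y [z [Sy Tz ->]]] [y' [z' [Sy' Tz' ->]]].
    by exists (y + y'), (z + z'); rewrite addrACA; split=> //; exact: subspaceD.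
  - move=> a x [y [z [Sy Tz ->]]].
    by exists (a *: y), (a *: z); rewrite scalerDr; split=> //; exact: subspaceZ.
move=> p q pq x [y [z [Sy Tz ->]]].
exists (pmod_map M pq y), (pmod_map M pq z).
by rewrite linearD; split=> //; exact: submod_map.
Defined.

Definition submod_le M (A B : submod M) : Prop := forall p x, A p x -> B p x.

Definition pmod_of_submod M (A : submod M) : pmod.
Proof.
exists (fun p => subspace_type (A p))
       (fun p q pq => subspace_map (submod_map (s := A) pq)).
- by move=> p pp x; apply: val_inj; exact: pmod_id.
- by move=> p q r pq qr pr x; apply: val_inj; exact: pmod_comp.
Defined.

Definition pmod_quot M (A : submod M) : pmod.
Proof.
exists (fun p => quot_type (A p))
       (fun p q pq => quot_map (submod_map (s := A) pq)).
- move=> p pp u; have [x ->] := quot_pi_surj u.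
  by rewrite /= quot_map_pi pmod_id.
- move=> p q r pq qr pr u; have [x ->] := quot_pi_surj u.
  by rewrite /= !quot_map_pi (pmod_comp _ _ pr).
Defined.

Definition subspace_preim (V W : lmodType k) (f : {linear V -> W})
  (A : subspace W) : subspace V.
Proof.
exists (fun x => A (f x)).
- by rewrite linear0; exact: subspace0.
- by move=> x y Ax Ay; rewrite linearD; exact: subspaceD.
- by move=> a x Ax; rewrite linearZ; exact: subspaceZ.
Defined.

(* [K] seen as a submodule of [I] (it is [I :&: K] if [K] is not below [I]). *)
Definition submod_restrict M (I K : submod M) : submod (pmod_of_submod I).
Proof.
exists (fun p => subspace_preim (val : {linear subspace_type (I p) -> M p}) (K p)).
by move=> p q pq x; exact: submod_map.
Defined.

Definition pmod_subquot M (I K : submod M) : pmod :=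
  pmod_quot (submod_restrict I K).

Definition is_subquot (P M : pmod) : Prop :=
  exists I K : submod M, submod_le K I /\ pmod_iso P (pmod_subquot I K).

Definition const_pmod : pmod.
Proof. by exists (fun=> k^o) (fun _ _ _ => idfun). Defined.

Record upset := Upset {
  upset_set :> 'rV[R]_d -> Prop;
  upset_up : forall p q, upset_set p -> lept p q -> upset_set q
}.

Definition upset_space (U : upset) (p : 'rV[R]_d) : subspace (k^o).
Proof.
exists (fun x => U p \/ x = 0).
- by right.
- by move=> x y [Up|->] [Up'|->]; [left|left|left|right; rewrite addr0].
- by move=> a x [Up|->]; [left|right; rewrite scaler0].
Defined.

Definition upset_submod (U : upset) : submod const_pmod.
Proof.
exists (upset_space U).
by move=> p q pq x [Up|->]; [left; exact: upset_up Up pq|right].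
Defined.

(* As a submodule of the constant module [k]: it is all of [k] at the points
   of [U], zero elsewhere, and its structure maps are identities on [U]. *)
Definition upset_pmod (U : upset) : pmod := pmod_of_submod (upset_submod U).

Definition upset_decomposable (M : pmod) : Prop :=
  exists (I : Type) (U : I -> upset),
    pmod_iso M (pmod_dsum (fun i => upset_pmod (U i))).

(* The barcode of [M] is the multiset of isomorphism classes of the family [F];
   [F] itself is only unique up to isomorphism and reindexing. *)
Definition is_barcode (M : pmod) (I : Type) (F : I -> pmod) : Prop :=
  (forall i, indecomposable (F i)) /\ pmod_iso M (pmod_dsum F).

(* Since [(p + e) + e] and [p + 2e] are not convertible, [M_(0 -> 2e)] appears
   here as the structure map from [p] to [(p + e) + e]. *)
Definition interleaved (e : {nonneg R}) (M N : pmod) : Prop :=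
  exists (phi : pmod_hom M (pmod_shift e%:num N))
         (psi : pmod_hom N (pmod_shift e%:num M)),
    (forall p x, psi (addpt p e%:num) (phi p x) =
       pmod_map M (lept_trans (lept_addr p e) (lept_addr _ e)) x) /\
    (forall p x, phi (addpt p e%:num) (psi p x) =
       pmod_map N (lept_trans (lept_addr p e) (lept_addr _ e)) x).

(* Sub-multisets of the barcodes are given by sets [A] and [B] of indices. *)
Definition has_matching (e : {nonneg R}) (M N : pmod) : Prop :=
  exists (I J : Type) (F : I -> pmod) (G : J -> pmod),
    [/\ is_barcode M F, is_barcode N G &
    exists (A : set I) (B : set J) (s : A -> B),
    [/\ bijective s,
        forall a : A, interleaved e (F (val a)) (G (val (s a))),
        forall i, ~ A i -> interleaved e (F i) zero_pmod &
        forall j, ~ B j -> interleaved e (G j) zero_pmod]].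

Definition bottleneck_dist (M N : pmod) : \bar R :=
  ereal_inf [set e%:num%:E | e in [set e : {nonneg R} | has_matching e M N]].

Section Pruning.
Variables (e : {nonneg R}) (M : pmod).

Let e2 : {nonneg R} := (2 * e%:num)%:nng.

(* [f(S)] is contained in [M_(0 -> 2e)(S)] for all [f : M -> M(2e)]. *)
Definition prune_stable (S : submod M) : Prop :=
  forall (f : pmod_hom M (pmod_shift (2 * e%:num) M)) p x, S p x ->
    exists2 y, S p y & f p x = pmod_trans M e2 p y.

Lemma prune_stable_zero : prune_stable (submod_zero M).
Proof. by move=> f p x /= ->; exists 0; rewrite ?linear0. Qed.

Lemma prune_stable_sum S T :
  prune_stable S -> prune_stable T -> prune_stable (submod_sum S T).
Proof.
move=> Ss Ts f p x [y [z [Sy Tz ->]]].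
have [y' Sy' fy] := Ss f p y Sy; have [z' Tz' fz] := Ts f p z Tz.
by exists (y' + z'); [exists y', z'|rewrite !linearD fy fz].
Qed.

(* The union of the stable submodules, which is a submodule since they are
   directed; see [prune_I_stable] and [prune_I_largest]. *)
Definition prune_I : submod M.
Proof.
unshelve eexists.
  move=> p; exists (fun x => exists2 S, prune_stable S & S p x).
  - by exists (submod_zero M) => //; exact: prune_stable_zero.
  - move=> x y [S Ss Sx] [T Ts Ty]; exists (submod_sum S T).
      exact: prune_stable_sum.
    by exists x, y.
  - by move=> a x [S Ss Sx]; exists S => //; exact: subspaceZ.
by move=> p q pq x [S Ss Sx]; exists S => //; exact: submod_map.
Defined.

Lemma prune_I_largest S : prune_stable S -> submod_le S prune_I.
Proof. by move=> Ss p x Sx; exists S. Qed.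

Lemma prune_I_stable : prune_stable prune_I.
Proof.
move=> f p x [S Ss Sx]; have [y Sy fy] := Ss f p x Sx.
by exists y => //; exists S.
Qed.

(* The preimage of [f(K)] under [I_(0 -> 2e)] is contained in [K]. *)
Definition prune_closed (K : submod M) : Prop :=
  forall (f : pmod_hom M (pmod_shift (2 * e%:num) M)) p x y,
    prune_I p x -> K p y -> pmod_trans M e2 p x = f p y -> K p x.

Lemma prune_closed_I : prune_closed prune_I.
Proof. by []. Qed.

Definition prune_K : submod M.
Proof.
unshelve eexists.
  move=> p; exists (fun x => forall K, submod_le K prune_I -> prune_closed K -> K p x).
  - by move=> K _ _; exact: subspace0.
  - by move=> x y Kx Ky K KI Kc; apply: subspaceD; [exact: Kx|exact: Ky].
  - by move=> a x Kx K KI Kc; apply: subspaceZ; exact: Kx.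
by move=> p q pq x Kx K KI Kc; apply: submod_map; exact: Kx.
Defined.

Lemma prune_K_le : submod_le prune_K prune_I.
Proof. by move=> p x; apply=> // ? ?. Qed.

Lemma prune_K_closed : prune_closed prune_K.
Proof.
move=> f p x y Ix Ky xy K KI Kc; exact: (Kc f p x y Ix (Ky K KI Kc) xy).
Qed.

Lemma prune_K_smallest K :
  submod_le K prune_I -> prune_closed K -> submod_le prune_K K.
Proof. by move=> KI Kc p x; exact. Qed.

Definition pruning : pmod :=
  pmod_shift (- e%:num) (pmod_subquot prune_I prune_K).

End Pruning.

Definition is_refinement (P M : pmod) : Prop :=
  exists (I : Type) (F G : I -> pmod),
    [/\ is_barcode M F,
        forall i, is_subquot (G i) (F i) &
        pmod_iso P (pmod_dsum G)].

Definition pruning_dist (M N : pmod) : \bar R :=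
  ereal_inf [set e%:num%:E | e in [set e : {nonneg R} |
    forall t : {nonneg R},
      is_refinement (pruning (e%:num + t%:num)%:nng M) (pruning t N) /\
      is_refinement (pruning (e%:num + t%:num)%:nng N) (pruning t M)]].

End Modules.

(* Main.v *)
From HB Require Import structures.
Require Import Defs.
From mathcomp Require Import all_boot all_order all_algebra all_reals ereal.
From mathcomp Require Import interval_inference all_classical.

Set Implicit Arguments.
Unset Strict Implicit.
Unset Printing Implicit Defensive.

Import Order.TTheory GRing.Theory Num.Theory.

(** For upset modules everything reduces to inclusions between upsets. A
    nonzero morphism from the module of [U] to the module of [V] exists only if
    [U] is contained in [V], because two points of R^d have a common upper bound
    and all structure maps are injective ([hom_coord_supp]).

    First, an [e]-matching becomes a family of inclusions. Every indecomposable
    summand of an upset-decomposable module is itself an upset module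
    ([summand_upset]), so that any barcode consists of upset modules. The maps
    M_(0 -> 2e) are injective on upset modules, hence a bar [e]-interleaved with
    zero is zero, and an [e]-matching is a bijection of the whole barcodes. It
    gives decompositions of [M] and [N] into the modules of upsets U_i and V_i
    indexed by the same set, with U_i + e inside V_i and V_i + e inside U_i
    ([matching_upsets]).

    Secondly, prunings are computed by combinatorics. If [M] is the direct sum
    of the modules of the U_i, write i -> j when U_i + 2t is contained in U_j.
    The condition on the submodule I in the definition of the [t]-pruning says
    exactly that I is the sum over i of the modules of the intersections of the
    U_j over all j reachable from i along ->, and injectivity of M_(0 -> 2t)
    forces K = 0 ([coords_pruning]).

    If i -> j holds for the V's and the parameter t, then U_i + 2(e + t) lies in
    V_i + e + 2t, hence in V_j + e, hence in U_j, so i -> j holds for the U's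
    and the parameter e + t. Thus the intersection computing
    the (e + t)-pruning of [M] runs over at least as many indices as the one
    for the t-pruning of [N], and up to the shifts each upset of the former
    is contained in the corresponding upset of the latter. So each summand of
    the first pruning is a submodule of a summand of the second one
    ([pruning_refinement]). The same holds with [M] and [N] exchanged, so
    every [e] admitting a matching is admissible in the infimum that defines the
    pruning distance. *)

(** * Morphisms and isomorphisms of persistence modules *)

Section ModuleIsomorphisms.
Local Open Scope classical_set_scope.
Local Open Scope ring_scope.
Variables (R : realType) (k : fieldType) (d : nat).
Implicit Types M N P : pmod R k d.

Definition linear_of (V W : lmodType k) (f : V -> W)
    (f_lin : forall a x y, f (a *: x + y) = a *: f x + f y) : {linear V -> W} :=
  HB.pack f (GRing.isLinear.Build k V W *:%R f f_lin).

Definition pmod_hom_comp M N P (g : pmod_hom N P) (f : pmod_hom M N) :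
  pmod_hom M P.
Proof.
exists (fun p => g p \o f p : {linear M p -> P p}).
by move=> p q pq x /=; rewrite !hom_nat.
Defined.

Lemma pmod_iso_sym M N : pmod_iso M N -> pmod_iso N M.
Proof. by move=> [f [g [fK gK]]]; exists g, f. Qed.

Lemma pmod_iso_trans N M P : pmod_iso M N -> pmod_iso N P -> pmod_iso M P.
Proof.
move=> [f [g [fK gK]]] [f' [g' [fK' gK']]].
exists (pmod_hom_comp f' f), (pmod_hom_comp g g').
by split=> p x /=; rewrite ?fK' ?fK ?gK ?gK'.
Qed.

Lemma bij_pmod_iso M N (f : pmod_hom M N) :
  (forall p x, f p x = 0 -> x = 0) -> (forall p y, exists x, f p x = y) ->
  pmod_iso M N.
Proof.
move=> f_inj f_surj.
have finj p x y : f p x = f p y -> x = y.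
  by move=> e; apply/eqP; rewrite -subr_eq0; apply/eqP/(f_inj p);
    rewrite linearB /= e subrr.
pose g p y : M p := projT1 (cid (f_surj p y)).
have gK p : cancel (g p) (f p) by move=> y; rewrite /g; case: cid.
have g_lin p a x y : g p (a *: x + y) = a *: g p x + g p y.
  by apply: finj; rewrite linearP !gK.
have g_nat p q (pq : lept p q) x :
    g q (pmod_map N pq x) = pmod_map M pq (g p x).
  by apply: finj; rewrite hom_nat !gK.
exists f, (@PmodHom R k d N M (fun p => linear_of (g_lin p)) g_nat).
by split=> p x /=; [apply: finj; rewrite gK|rewrite gK].
Qed.

Definition dsum_hom I (F G : I -> pmod R k d)
  (h : forall i, pmod_hom (F i) (G i)) : pmod_hom (pmod_dsum F) (pmod_dsum G).
Proof.
exists (fun p => dsum_map (fun i => h i p)) => p q pq x.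
apply: val_inj; apply: functional_extensionality_dep => i /=.
by rewrite /dprod_map hom_nat.
Defined.

Lemma pmod_iso_dsum I (F G : I -> pmod R k d) :
  (forall i, pmod_iso (F i) (G i)) -> pmod_iso (pmod_dsum F) (pmod_dsum G).
Proof.
move=> FG.
pose f i := projT1 (cid (FG i)); pose g i := projT1 (cid (projT2 (cid (FG i)))).
have gP i := projT2 (cid (projT2 (cid (FG i)))) : _ /\ _.
exists (dsum_hom f), (dsum_hom g).
split=> p x /=; apply: val_inj; apply: functional_extensionality_dep => i /=;
  by have [fK gK] := gP i; rewrite /dprod_map ?fK ?gK.
Qed.

End ModuleIsomorphisms.

(** * Coordinates with respect to a decomposition into upset modules *)

Section Coordinates.
Local Open Scope classical_set_scope.
Local Open Scope ring_scope.
Variables (R : realType) (k : fieldType) (d : nat).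
Implicit Types M N P : pmod R k d.

(** An isomorphism from [M] to the direct sum of the modules of the upsets
    [U i], given by its scalar coordinates. In this form decompositions restrict
    to submodules and pass to shifts and reindexings without handling elements
    of nested subtypes; [iso_of_coords] and [coords_dsum] translate back to
    isomorphisms. *)
Record upset_coords M I (U : I -> upset R d) := UpsetCoords {
  ucoord :> forall p, M p -> I -> k;
  ucoord_lin : forall p a (x y : M p) i,
    ucoord (a *: x + y) i = a * ucoord x i + ucoord y i;
  ucoord_map : forall p q (pq : @lept R d p q) (x : M p) i,
    ucoord (pmod_map M pq x) i = ucoord x i;
  ucoord_inj : forall p (x : M p), (forall i, ucoord x i = 0) -> x = 0;
  ucoord_supp : forall p (x : M p) i, ucoord x i != 0 -> U i p;
  ucoord_fin : forall p (x : M p), finite_set [set i | ucoord x i != 0];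
  ucoord_surj : forall p (y : I -> k), finite_set [set i | y i != 0] ->
    (forall i, y i != 0 -> U i p) -> exists x : M p, forall i, ucoord x i = y i
}.

Section Theory.
Variables (M : pmod R k d) (I : Type) (U : I -> upset R d).
Variable (c : upset_coords M U).

Lemma ucoordD p (x y : M p) i : c p (x + y) i = c p x i + c p y i.
Proof. by rewrite -[x]scale1r ucoord_lin mul1r scale1r. Qed.

Lemma ucoord0 p i : c p 0 i = 0.
Proof. by apply: (addrI (c p 0 i)); rewrite -ucoordD !addr0. Qed.

Lemma ucoordZ p a (x : M p) i : c p (a *: x) i = a * c p x i.
Proof. by rewrite -[a *: x]addr0 ucoord_lin ucoord0 addr0. Qed.

Lemma ucoordB p (x y : M p) i : c p (x - y) i = c p x i - c p y i.
Proof. by rewrite ucoordD -scaleN1r ucoordZ mulN1r. Qed.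

Lemma ucoord_eq p (x y : M p) : (forall i, c p x i = c p y i) -> x = y.
Proof.
move=> e; apply/eqP; rewrite -subr_eq0; apply/eqP/(ucoord_inj (u := c)) => i.
by rewrite ucoordB e subrr.
Qed.

Lemma basis_subproof i p : exists x : M p, forall j,
  c p x j = if `[< U i p /\ i = j >] then 1 else 0.
Proof.
apply: ucoord_surj => [|j]; last first.
  by case: asboolP => [[Uip <-]//|_]; rewrite eqxx.
apply: sub_finite_set (finite_set1 i) => j /=.
by case: asboolP => [[_ ->]//|_]; rewrite eqxx.
Qed.

(** The generator of the [i]-th summand at [p]; it is 0 when [p] lies outside
    of [U i]. *)
Definition basis_vec i p : M p := projT1 (cid (basis_subproof i p)).

Lemma ucoord_basis i p j :
  c p (basis_vec i p) j = if `[< U i p /\ i = j >] then 1 else 0.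
Proof. by rewrite /basis_vec; case: cid. Qed.

Lemma ucoord_basis_id i p : U i p -> c p (basis_vec i p) i = 1.
Proof. by move=> Uip; rewrite ucoord_basis; case: asboolP => // -[]. Qed.

Lemma basis_map i p q (pq : lept p q) :
  U i p -> pmod_map M pq (basis_vec i p) = basis_vec i q.
Proof.
move=> Uip; apply: ucoord_eq => j; rewrite ucoord_map !ucoord_basis.
have Uiq := upset_up Uip pq.
by do 2![case: asboolP]; tauto.
Qed.

(** [x] is a combination of the [basis_vec i p] with [i] in its support. The
    induction peels these terms off one at a time, along a list that contains
    the support. *)
Lemma functional_supp (V : lmodType k) p (phi : {linear M p -> V}) (x : M p) :
  phi x <> 0 -> exists2 i, c p x i != 0 & phi (basis_vec i p) <> 0.
Proof.
move=> phix; apply: contrapT => noi.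
have phi0 i : c p x i != 0 -> phi (basis_vec i p) = 0.
  by move=> xi; apply: contrapT => h; apply: noi; exists i.
have /(@finite_seqP {classic I}) [s sE] := ucoord_fin c x.
apply: phix.
have {sE} : forall i, c p x i != 0 -> (i : {classic I}) \in s.
  move=> i xi; have : [set i | c p x i != 0] i by [].
  by rewrite sE.
elim: s => [|j s IH] in x {noi} phi0 *.
  move=> xs; suff -> : x = 0 by rewrite linear0.
  apply: (ucoord_inj (u := c)) => i; apply/eqP/negPn/negP => /xs.
  by rewrite in_nil.
(* If [j] is not in the support the list can be shortened right away;
   otherwise subtract the [j]-th component of [x]. *)
have [/eqP xj0|xj0] := boolP (c p x j == 0).
  move=> xs; apply: IH => // i xi; move: (xs i xi).
  by rewrite inE => /orP[/eqP ij|//]; move: xi; rewrite ij xj0 eqxx.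
move=> xs; pose x' := x - c p x j *: basis_vec j p.
have x'j : c p x' j = 0.
  by rewrite ucoordB ucoordZ ucoord_basis_id ?mulr1 ?subrr //;
    exact: ucoord_supp xj0.
have x'i i : i <> j -> c p x' i = c p x i.
  move=> ij; rewrite ucoordB ucoordZ ucoord_basis.
  by case: asboolP => [[_ ji]|]; [case: ij|rewrite mulr0 subr0].
have supp' i : c p x' i != 0 -> c p x i != 0 /\ i <> j.
  move=> h; have ij : i <> j by move=> ij; rewrite ij x'j eqxx in h.
  by split=> //; rewrite -x'i.
have : phi x' = 0.
  apply: IH => [i /supp'[/phi0]//|i /supp'[/xs]].
  by rewrite inE => /orP[/eqP|].
by rewrite linearB linearZ /= phi0 // scaler0 subr0.
Qed.

End Theory.

Arguments ucoord_eq {M I U} c {p x y}.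
Arguments ucoord_inj {M I U} u {p x}.

Lemma lept_ub (p q : 'rV[R]_d) : exists r, lept p r /\ lept q r.
Proof.
exists (\row_i Num.max (p 0 i) (q 0 i)).
by split=> i; rewrite mxE le_max lexx ?orbT.
Qed.

Definition ucoord_linear M I (U : I -> upset R d) (c : upset_coords M U) p i :
    {linear M p -> k^o} :=
  @linear_of k (M p) k^o (fun x => c p x i) (fun a x y => ucoord_lin c a x y i).

(** The [j]-th coordinate of a generator of the [i]-th summand is constant along
    [U i]: its values at two points agree at any common upper bound. So if it is
    nonzero at one point it is nonzero at all points of [U i], which must then
    lie in [V j]. *)
Lemma hom_coord_supp M N I J (U : I -> upset R d) (V : J -> upset R d)
    (c : upset_coords M U) (c' : upset_coords N V) (f : pmod_hom M N)
    p (x : M p) j :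
  c' p (f p x) j != 0 ->
  exists i, [/\ c p x i != 0, c' p (f p (basis_vec c i p)) j != 0 &
                forall q, U i q -> V j q].
Proof.
move=> /eqP fxj.
have [i xi bi] := functional_supp c
  (phi := ucoord_linear c' p j \o f p) fxj.
exists i; split=> //; first exact/eqP.
move=> q Uiq; have [r [pr qr]] := lept_ub p q.
have Uip := ucoord_supp xi.
have : c' r (f r (basis_vec c i r)) j != 0.
  by rewrite -(basis_map c pr Uip) hom_nat ucoord_map; exact/eqP.
by rewrite -(basis_map c qr Uiq) hom_nat ucoord_map => h; exact: ucoord_supp h.
Qed.

Definition coords_dsum I (U : I -> upset R d) :
  upset_coords (pmod_dsum (fun i => upset_pmod k (U i))) U.
Proof.
exists (fun p (x : pmod_dsum (fun i => upset_pmod k (U i)) p) i =>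
  val ((val x : dprod (fun i => upset_pmod k (U i) p)) i) : k) => //.
- move=> p x x0; apply: val_inj; apply: functional_extensionality_dep => i.
  exact/val_inj/x0.
- move=> p x i /eqP; case: (val x i) => y /= /subspace_memP /=; tauto.
- move=> p x; have /subspace_memP := valP x.
  apply: sub_finite_set => i /=; apply: contra_neq => ->.
  by [].
- move=> p y yfin ysupp.
  have yP i : upset_space k (U i) p (y i).
    by have [->|/ysupp] := eqVneq (y i) 0; [right|left].
  have xfin : dsum_space _ ((fun i => subspace_elt (yP i)) :
      dprod (fun i => upset_pmod k (U i) p)).
    apply: sub_finite_set yfin => i /=; apply: contra_neq => yi0.
    exact: val_inj.
  by exists (subspace_elt xfin).
Defined.

Definition coords_transfer M N I (U : I -> upset R d) (f : pmod_hom M N)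
  (g : pmod_hom N M) (fK : forall p, cancel (f p) (g p))
  (gK : forall p, cancel (g p) (f p)) (c : upset_coords M U) :
  upset_coords N U.
Proof.
exists (fun p x => c p (g p x)).
- by move=> p a x y i; rewrite linearP ucoord_lin.
- by move=> p q pq x i; rewrite hom_nat ucoord_map.
- by move=> p x /ucoord_inj gx0; rewrite -[x]gK gx0 linear0.
- by move=> p x i xi; exact: ucoord_supp xi.
- by move=> p x; exact: ucoord_fin.
- move=> p y yfin ysupp; have [x xE] := ucoord_surj c yfin ysupp.
  by exists (f p x) => i; rewrite fK.
Defined.

Lemma coords_iso M N I (U : I -> upset R d) :
  pmod_iso M N -> upset_coords M U -> inhabited (upset_coords N U).
Proof. by move=> [f [g [fK gK]]] c; split; exact: coords_transfer fK gK c. Qed.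

Lemma iso_of_coords M N I (U : I -> upset R d) :
  upset_coords M U -> upset_coords N U -> pmod_iso M N.
Proof.
move=> c c'.
have fP p (x : M p) : exists y : N p, forall i, c' p y i = c p x i.
  by apply: ucoord_surj => [|i xi]; [exact: ucoord_fin|exact: ucoord_supp xi].
pose f p (x : M p) := projT1 (cid (fP p x)).
have fE p x i : c' p (f p x) i = c p x i.
  by rewrite /f; case: cid.
have f_lin p a x y : f p (a *: x + y) = a *: f p x + f p y.
  by apply: (ucoord_eq c') => i; rewrite ucoord_lin !fE ucoord_lin.
have f_nat p q (pq : lept p q) x :
    f q (pmod_map M pq x) = pmod_map N pq (f p x).
  by apply: (ucoord_eq c') => i; rewrite ucoord_map !fE ucoord_map.
apply: (@bij_pmod_iso _ _ _ _ _
  (@PmodHom R k d M N (fun p => linear_of (f_lin p)) f_nat)) => p.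
- move=> x /= fx0; apply: (ucoord_inj c) => i.
  by rewrite -fE fx0 ucoord0.
- move=> y; have [x xE] : exists x : M p, forall i, c p x i = c' p y i.
    by apply: ucoord_surj => [|i xi]; [exact: ucoord_fin|exact: ucoord_supp xi].
  by exists x; apply: (ucoord_eq c') => i /=; rewrite fE.
Qed.


Definition upset_shift (e : R) (U : upset R d) : upset R d.
Proof.
exists (fun p => U (addpt p e)) => p q Up pq.
exact: upset_up Up (lept_add e pq).
Defined.

Definition coords_shift M I (U : I -> upset R d) e (c : upset_coords M U) :
  upset_coords (pmod_shift e M) (fun i => upset_shift e (U i)).
Proof.
exists (fun p => c (addpt p e)).
- by move=> p a x y i; exact: ucoord_lin.
- by move=> p q pq x i; exact: ucoord_map.
- by move=> p x; exact: ucoord_inj.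
- by move=> p x i; exact: ucoord_supp.
- by move=> p x; exact: ucoord_fin.
- by move=> p y; exact: (ucoord_surj c (p := addpt p e)).
Defined.

(** Only the nonempty upsets matter, so [s] may miss indices of empty upsets.
    This covers bijections as well as the removal of zero summands. *)
Lemma reindex_coords M I J (U : J -> upset R d) (s : I -> J) :
  injective s -> (forall j p, U j p -> exists i, s i = j) ->
  upset_coords M U -> upset_coords M (U \o s).
Proof.
move=> s_inj s_surj c; exists (fun p x i => c p x (s i)).
- by move=> p a x y i; rewrite ucoord_lin.
- by move=> p q pq x i; rewrite ucoord_map.
- move=> p x x0; apply: (ucoord_inj c) => j.
  apply/eqP/negPn/negP => xj; have [i ij] := s_surj _ _ (ucoord_supp xj).
  by move: xj; rewrite -ij x0 eqxx.
- by move=> p x i xi; exact: ucoord_supp xi.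
- move=> p x; apply: (finite_preimage _ (ucoord_fin c x)) => i j _ _.
  exact: s_inj.
- move=> p y yfin ysupp.
  pose z j := if pselect (exists i, s i = j) is left e then y (projT1 (cid e))
              else 0.
  have zs i : z (s i) = y i.
    rewrite /z; case: pselect => [e|[]]; last by exists i.
    by case: (cid e) => i' /= /s_inj ->.
  have z0 j : z j != 0 -> exists i, s i = j.
    by rewrite /z; case: pselect => // _; rewrite eqxx.
  have [x xz] : exists x : M p, forall j, c p x j = z j.
    apply: ucoord_surj => [|j zj].
      apply: sub_finite_set (finite_image s yfin) => j /= zj.
      by have [i ij] := z0 j zj; exists i => //=; rewrite -zs ij.
    by have [i ij] := z0 j zj; rewrite -ij; apply: ysupp; rewrite -zs ij.
  by exists x => i; rewrite xz zs.
Qed.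

Definition coords_upset (U : upset R d) :
  upset_coords (upset_pmod k U) (fun _ : unit => U).
Proof.
exists (fun p (x : upset_pmod k U p) _ => val x : k) => //.
- by move=> p x x0; apply: val_inj; exact: (x0 tt).
- by move=> p x _ /eqP; case: x => y /= /subspace_memP /=; tauto.
- move=> p y _ ysupp.
  have yP : upset_space k U p (y tt).
    by have [->|/ysupp] := eqVneq (y tt) 0; [right|left].
  by exists (subspace_elt yP) => -[].
Defined.

(** The characterization of [A] makes it the direct sum of its intersections
    with the summands, each of which is again an upset module. *)
Lemma coords_submod M I (U U' : I -> upset R d) (c : upset_coords M U)
    (A : submod M) :
  (forall p x, A p x <-> forall i, c p x i != 0 -> U' i p) ->
  (forall i p, U' i p -> U i p) ->
  upset_coords (pmod_of_submod A) U'.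
Proof.
move=> AE U'U; exists (fun p (x : pmod_of_submod A p) => c p (val x)).
- by move=> p a x y i; rewrite -ucoord_lin.
- by move=> p q pq x i; exact: ucoord_map.
- by move=> p x x0; apply/val_inj/(ucoord_inj c).
- move=> p x i; have /subspace_memP := valP x; move=> /AE; exact.
- by move=> p x; exact: ucoord_fin.
- move=> p y yfin ysupp.
  have [x xy] := ucoord_surj c yfin (fun i yi => U'U i p (ysupp i yi)).
  have Ax : A p x by apply/AE => i; rewrite xy; exact: ysupp.
  by exists (subspace_elt Ax).
Qed.

Lemma subquot_zero_iso M (A K : submod M) :
  (forall p x, K p x -> x = 0) ->
  pmod_iso (pmod_of_submod A) (pmod_subquot A K).
Proof.
move=> K0.
have nat p q (pq : lept p q) (x : pmod_of_submod A p) :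
  quot_pi (submod_restrict A K q) (pmod_map (pmod_of_submod A) pq x) =
  pmod_map (pmod_subquot A K) pq (quot_pi (submod_restrict A K p) x).
  by rewrite [RHS]quot_map_pi.
apply: (@bij_pmod_iso _ _ _ _ _ (@PmodHom R k d (pmod_of_submod A)
  (pmod_subquot A K) (fun p => @quot_pi _ _ (submod_restrict A K p)) nat)).
- move=> p x /= x0; apply: val_inj; apply: (K0 p).
  have /quot_piP : quot_pi (submod_restrict A K p) x = quot_pi _ 0.
    by rewrite x0 linear0.
  by rewrite subr0.
- by move=> p y; have [x ->] := quot_pi_surj y; exists x.
Qed.

Lemma coords_subquot M I (U U' : I -> upset R d) (c : upset_coords M U)
    (A K : submod M) :
  (forall p x, A p x <-> forall i, c p x i != 0 -> U' i p) ->
  (forall i p, U' i p -> U i p) -> (forall p x, K p x -> x = 0) ->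
  inhabited (upset_coords (pmod_subquot A K) U').
Proof.
move=> AE U'U K0.
exact: coords_iso (subquot_zero_iso A K0) (coords_submod AE U'U).
Qed.

(** The elementary matrix with entry [a] in position [(j, i)]. *)
Definition elementary_hom M N I J (U : I -> upset R d) (V : J -> upset R d)
  (c : upset_coords M U) (c' : upset_coords N V) (a : k) i j
  (UV : forall p, U i p -> V j p) : pmod_hom M N.
Proof.
unshelve eexists.
  move=> p.
  apply: (@linear_of _ _ _ (fun x => (a * c p x i) *: basis_vec c' j p)).
  by move=> b x y; rewrite ucoord_lin scalerA -scalerDl mulrDr mulrCA.
move=> p q pq x /=; rewrite ucoord_map linearZ /=.
have [->|xi] := eqVneq (c p x i) 0; first by rewrite mulr0 !scale0r.
by rewrite basis_map //; exact/UV/ucoord_supp/xi.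
Defined.

End Coordinates.

Arguments ucoord_eq {R k d M I U} c {p x y}.
Arguments elementary_hom {R k d M N I J U V} c c' a i j UV.
Arguments ucoord_inj {R k d M I U} u {p x}.

(** * Upset modules are the only summands of their direct sums *)

Section Decomposition.
Local Open Scope classical_set_scope.
Local Open Scope ring_scope.
Variables (R : realType) (k : fieldType) (d : nat).
Implicit Types M N P : pmod R k d.

Lemma not_zero_pmod M : ~ is_zero_pmod M -> exists p (x : M p), x <> 0.
Proof.
move=> M0; apply: contrapT => h; apply: M0 => p x.
by apply: contrapT => x0; apply: h; exists p, x.
Qed.

Definition dsum_proj I (F : I -> pmod R k d) i : pmod_hom (pmod_dsum F) (F i).
Proof.
unshelve eexists.
  move=> p; apply: (@linear_of _ (pmod_dsum F p) _
    (fun x => (val x : dprod (fun i => F i p)) i)).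
  by [].
by [].
Defined.

Section Inclusion.
Variables (I : Type) (F : I -> pmod R k d) (i : I).

Definition delta_fun p (x : F i p) : dprod (fun j => F j p) :=
  fun j => if pselect (i = j) is left e then eq_rect i (fun j => F j p) x j e
           else 0.

Lemma delta_fun_finsupp p (x : F i p) : dsum_space _ (delta_fun x).
Proof.
apply: sub_finite_set (finite_set1 i) => j /=; rewrite /delta_fun.
by case: pselect => [e _|_]; [exact: esym e|rewrite eqxx].
Qed.

Definition dsum_elt p (x : F i p) : pmod_dsum F p :=
  subspace_elt (delta_fun_finsupp x).

Lemma dsum_elt_linear p a x y :
  dsum_elt (a *: x + y : F i p) = a *: dsum_elt x + dsum_elt y.
Proof.
apply: val_inj; apply: functional_extensionality_dep => j /=.
rewrite /delta_fun /GRing.add /= /GRing.scale /=.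
case: pselect => [e|_]; first by case: _ / e.
by rewrite scaler0 addr0.
Qed.

Lemma dsum_elt_map p q (pq : lept p q) (x : F i p) :
  dsum_elt (pmod_map (F i) pq x) = pmod_map (pmod_dsum F) pq (dsum_elt x).
Proof.
apply: val_inj; apply: functional_extensionality_dep => j /=.
rewrite /dprod_map /delta_fun; case: pselect => [e|_]; first by case: _ / e.
by rewrite linear0.
Qed.

Definition dsum_inj : pmod_hom (F i) (pmod_dsum F) :=
  @PmodHom R k d (F i) (pmod_dsum F) (fun p => linear_of (@dsum_elt_linear p))
    dsum_elt_map.

End Inclusion.

Lemma dsum_injK I (F : I -> pmod R k d) i p (x : F i p) :
  dsum_proj F i p (dsum_inj F i p x) = x.
Proof.
rewrite /= /delta_fun; case: pselect => [e|ne]; last by case: (ne erefl).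
by rewrite (Prop_irrelevance e erefl).
Qed.

Lemma dsum_inj_neq I (F : I -> pmod R k d) i j p (x : F i p) :
  i <> j -> dsum_proj F j p (dsum_inj F i p x) = 0.
Proof. by move=> ij; rewrite /= /delta_fun; case: pselect. Qed.

Lemma upset_pmod_neq0 (U : upset R d) p :
  U p -> ~ is_zero_pmod (upset_pmod k U).
Proof.
move=> Up P0; pose c := coords_upset k U.
have := ucoord_basis_id c (i := tt) Up.
by rewrite (P0 p (basis_vec c tt p)) ucoord0 => /esym/eqP; rewrite oner_eq0.
Qed.

(** Nonzero elements of two summands can be moved to a common point, where the
    space of the upset module is a line. There they stay nonzero, by injectivity
    of the structure maps, but would be linearly independent. *)
Lemma upset_pmod_indecomposable (U : upset R d) p :
  U p -> indecomposable (upset_pmod k U).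
Proof.
move=> Up; split; first exact: upset_pmod_neq0 Up.
move=> A B PAB; apply: contrapT => /not_orP[/not_zero_pmod[q [x x0]]].
move=> /not_zero_pmod[q' [y y0]].
have [c] := coords_iso PAB (coords_upset k U).
pose F (b : bool) := if b then A else B.
pose a := dsum_inj F true q x : pmod_sum2 A B q.
pose b := dsum_inj F false q' y : pmod_sum2 A B q'.
have ca0 : c q a tt != 0.
  apply/eqP => h; apply: x0; rewrite -[x](dsum_injK (F := F) (i := true)).
  by rewrite -/a [a](ucoord_inj c) ?linear0 // => -[].
have cb0 : c q' b tt != 0.
  apply/eqP => h; apply: y0; rewrite -[y](dsum_injK (F := F) (i := false)).
  by rewrite -/b [b](ucoord_inj c) ?linear0 // => -[].
have [r [qr qr']] := lept_ub q q'.
pose a' := pmod_map (pmod_sum2 A B) qr a.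
pose b' := pmod_map (pmod_sum2 A B) qr' b.
have ab : c q' b tt *: a' = c q a tt *: b'.
  by apply: (ucoord_eq c) => -[]; rewrite !ucoordZ !ucoord_map mulrC.
have a'E : a' = dsum_inj F true r (pmod_map A qr x).
  by rewrite (hom_nat (dsum_inj F true)).
have b'E : b' = dsum_inj F false r (pmod_map B qr' y).
  by rewrite (hom_nat (dsum_inj F false)).
have /eqP : c q' b tt *: pmod_map A qr x = 0.
  have := congr1 (dsum_proj F true r) ab.
  by rewrite a'E b'E !linearZ_LR !dsum_injK dsum_inj_neq // scaler0.
rewrite scaler_eq0 (negPf cb0) /= => /eqP x'0.
suff : c q a tt = 0 by move/eqP; rewrite (negPf ca0).
by rewrite -(ucoord_map c qr) -/a' a'E x'0 linear0 ucoord0.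
Qed.

Section Retract.
Variables (F P : pmod R k d) (alpha : pmod_hom P F) (beta : pmod_hom F P).
Hypothesis alphaK : forall p, cancel (alpha p) (beta p).

Definition hom_ker : submod F.
Proof.
unshelve eexists.
  move=> p; exists (fun x => beta p x = 0); first by rewrite linear0.
    by move=> x y x0 y0; rewrite linearD x0 y0 addr0.
  by move=> a x x0; rewrite linearZ /= x0 scaler0.
by move=> p q pq x /= x0; rewrite hom_nat x0 linear0.
Defined.

(** F is the internal direct sum of the image of [alpha] and the kernel of
    [beta]. *)
Lemma retract_split : pmod_iso (pmod_sum2 P (pmod_of_submod hom_ker)) F.
Proof.
pose G (b : bool) := if b then P else pmod_of_submod hom_ker.
pose prP := dsum_proj G true; pose prK := dsum_proj G false.
have f_lin p a (x y : pmod_dsum G p) :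
    alpha p (prP p (a *: x + y)) + val (prK p (a *: x + y)) =
    a *: (alpha p (prP p x) + val (prK p x)) +
    (alpha p (prP p y) + val (prK p y)).
  by rewrite (linearP (prP p)) (linearP (prK p)) !linearP scalerDr addrACA.
have f_nat p q (pq : lept p q) (x : pmod_dsum G p) :
    alpha q (prP q (pmod_map (pmod_dsum G) pq x)) +
    val (prK q (pmod_map (pmod_dsum G) pq x)) =
    pmod_map F pq (alpha p (prP p x) + val (prK p x)).
  by rewrite linearD -hom_nat.
have kerP p (x : pmod_of_submod hom_ker p) : beta p (val x) = 0.
  exact: (elimT (subspace_memP _ _) (valP x)).
apply: (@bij_pmod_iso _ _ _ _ _ (@PmodHom R k d (pmod_dsum G) F
  (fun p => linear_of (f_lin p)) f_nat)) => p.
- move=> x /= fx0.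
  have x1 : prP p x = 0.
    have := congr1 (beta p) fx0.
    rewrite linearD alphaK (kerP p (prK p x)) addr0 => e.
    exact: etrans e (linear0 _).
  have x2 : prK p x = 0.
    apply: val_inj; move: fx0.
    change (alpha p (prP p x) + val (prK p x) = 0 -> val (prK p x) = 0).
    by rewrite x1 linear0 add0r.
  by apply: val_inj; apply: functional_extensionality_dep => -[].
- move=> y.
  have yK : hom_ker p (y - alpha p (beta p y)).
    by rewrite /= linearB /= alphaK subrr.
  pose z := dsum_inj G true p (beta p y) +
            dsum_inj G false p (subspace_elt yK : pmod_of_submod hom_ker p).
  have z1 : prP p z = beta p y.
    by rewrite linearD dsum_injK dsum_inj_neq // addr0.
  have z2 : prK p z = subspace_elt yK.
    by rewrite linearD dsum_injK dsum_inj_neq // add0r.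
  exists z; change (alpha p (prP p z) + val (prK p z) = y).
  by rewrite z1 z2 /= addrC subrK.
Qed.

Lemma retract_indecomposable :
  indecomposable F -> ~ is_zero_pmod P -> pmod_iso F P.
Proof.
move=> [_ Find] P0; case: (Find _ _ (pmod_iso_sym retract_split)) => // K0.
apply: (@bij_pmod_iso _ _ _ _ _ beta) => p.
- by move=> x x0; have := congr1 val (K0 p (subspace_elt (x0 : hom_ker p x))).
- by move=> y; exists (alpha p y); rewrite alphaK.
Qed.

End Retract.

(** [le] is only a preorder, as distinct indices may carry the same upset; so
    minimality means that a smaller element is equivalent. *)
Lemma seq_minimal (T : eqType) (le : T -> T -> Prop) (s : seq T)
    (P : T -> Prop) :
  (forall x, le x x) -> (forall y x z, le x y -> le y z -> le x z) ->
  (exists2 x, x \in s & P x) ->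
  exists2 x, P x & forall y, y \in s -> P y -> le y x -> le x y.
Proof.
move=> refl trans; elim: s => [[x]|a s IH [x0]]; first by rewrite in_nil.
rewrite inE => x0as Px0.
have [[x xs Px]|ns] := pselect (exists2 x, x \in s & P x).
  have [m Pm mmin] := IH (ex_intro2 _ _ x xs Px).
  have [[Pa [am nma]]|h] := pselect (P a /\ le a m /\ ~ le m a).
    exists a => // y; rewrite inE => /orP[/eqP-> //|ys] Py ya.
    by case: nma; apply: trans (mmin y ys Py (trans _ _ _ ya am)) ya.
  exists m => // y; rewrite inE => /orP[/eqP-> Pa am|]; last exact: mmin.
  by apply: contrapT => nma; apply: h.
have Pa : P a.
  by case/orP: x0as => [/eqP<-//|x0s]; case: ns; exists x0.
exists a => // y; rewrite inE => /orP[/eqP->//|ys] Py; by case: ns; exists y.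
Qed.

(** Let [T] be the idempotent of [M] projecting to [F j], and [m] a nonzero
    vector with [T m = m]. Among the upsets in the support of [m] take a minimal
    one, [U a]. As the [a]-th coordinate of [T m] is nonzero, some [b] in the support
    of [m] has a nonzero matrix entry of [T] from [b] to [a]. Then [U b] is
    contained in [U a], and both agree by minimality. So the module of [U a]
    maps to [F j] through the summand [b] and back through the coordinate [a],
    the composite being a nonzero scalar: it is a retract of the indecomposable
    [F j]. Choosing [b] apart from [a] matters when an upset is repeated: the
    diagonal entries of [T] may then all vanish. *)
Lemma summand_upset M I J (U : I -> upset R d) (F : J -> pmod R k d) j :
  upset_coords M U -> pmod_iso M (pmod_dsum F) -> indecomposable (F j) ->
  exists i, pmod_iso (F j) (upset_pmod k (U i)).
Proof.
move=> c [g [h [gK hK]]] Find.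
have [p [x x0]] := not_zero_pmod Find.1.
pose inc := pmod_hom_comp h (dsum_inj F j).
pose pro := pmod_hom_comp (dsum_proj F j) g.
have incK q : cancel (inc q) (pro q).
  move=> y; change (dsum_proj F j q (g q (h q (dsum_inj F j q y))) = y).
  by rewrite hK dsum_injK.
pose T := pmod_hom_comp inc pro.
pose m := inc p x.
have Tm : T p m = m by change (inc p (pro p (inc p x)) = inc p x); rewrite incK.
have [a0 ma0] : exists a, c p m a != 0.
  apply: contrapT => noa; apply: x0; rewrite -[x]incK -/m.
  suff -> : m = 0 by rewrite linear0.
  apply: (ucoord_inj c) => i; apply: contrapT => /eqP mi.
  by apply: noa; exists i.
have /(@finite_seqP {classic I}) [s sE] := ucoord_fin c m.
have ins i : c p m i != 0 -> (i : {classic I}) \in s.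
  by move=> mi; have : [set i | c p m i != 0] i by []; rewrite sE.
have [a ma amin] := @seq_minimal {classic I}
  (fun i i' => forall q, U i q -> U i' q) s (fun i => c p m i != 0)
  (fun _ _ => id) (fun y x z xy yz q Uq => yz q (xy q Uq))
  (ex_intro2 _ _ a0 (ins a0 ma0) ma0).
have [b [mb Tb Uba]] : exists i, [/\ c p m i != 0,
    c p (T p (basis_vec c i p)) a != 0 & forall q, U i q -> U a q].
  by apply: hom_coord_supp; rewrite Tm.
have Uab := amin b (ins b mb) mb Uba.
(* The matrix entry of [T] from [b] to [a]; it does not depend on the point. *)
pose l := c p (T p (basis_vec c b p)) a.
have TE q : U b q -> c q (T q (basis_vec c b q)) a = l.
  move=> Ubq; have [r [pr qr]] := lept_ub p q.
  have Ubp := ucoord_supp mb.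
  rewrite -(ucoord_map c qr) -hom_nat (basis_map c qr Ubq).
  by rewrite -(basis_map c pr Ubp) hom_nat ucoord_map.
pose cP := coords_upset k (U a).
pose alpha := pmod_hom_comp pro (elementary_hom cP c l^-1 tt b Uab).
pose beta := pmod_hom_comp (elementary_hom c cP 1 a tt (fun q => id)) inc.
exists a; apply: (@retract_indecomposable _ _ alpha beta) => //.
- move=> q y; apply: (ucoord_eq cP) => -[].
  have [yt|yt] := eqVneq (cP q y tt) 0.
    have -> : y = 0 by apply: (ucoord_inj cP) => -[].
    by rewrite !linear0.
  have Uaq := ucoord_supp yt.
  have -> : beta q (alpha q y) =
      (1 * c q (T q ((l^-1 * cP q y tt) *: basis_vec c b q)) a) *:
      basis_vec cP tt q.
    by [].
  rewrite linearZ_LR !ucoordZ ucoord_basis_id // TE; last exact (Uab q Uaq).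
  by rewrite mul1r mulr1 mulrAC mulVf // mul1r.
- exact: upset_pmod_neq0 (ucoord_supp ma).
Qed.

End Decomposition.

(** * Prunings of direct sums of upset modules *)

Section Pruning.
Local Open Scope classical_set_scope.
Local Open Scope ring_scope.
Variables (R : realType) (k : fieldType) (d : nat).
Implicit Types M N P : pmod R k d.

Section PrunedUpsets.
Variables (I : Type) (U : I -> upset R d) (s : R).

Inductive shift_reach (i : I) : I -> Prop :=
| shift_reach_refl : shift_reach i i
| shift_reach_step j l : shift_reach i j ->
    (forall p, U j p -> U l (addpt p s)) -> shift_reach i l.

Definition pruned_upset (i : I) : upset R d.
Proof.
exists (fun p => forall j, shift_reach i j -> U j p).
by move=> p q Up pq j ij; exact: upset_up (Up j ij) pq.
Defined.

Lemma shift_reach_cons i j l : (forall p, U i p -> U j (addpt p s)) ->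
  shift_reach j l -> shift_reach i l.
Proof.
move=> ij; elim=> [|l' m _ il' l'm]; last exact: shift_reach_step il' l'm.
exact: shift_reach_step (shift_reach_refl i) ij.
Qed.

End PrunedUpsets.

Section PruningCoordinates.
Variables (M : pmod R k d) (I : Type) (U : I -> upset R d).
Variables (c : upset_coords M U) (e : {nonneg R}).

Let U' := pruned_upset U (2 * e%:num).
Let cs := coords_shift (2 * e%:num) c.

(** In coordinates M_(0 -> 2e) is the identity, which is why it is injective. *)
Lemma ucoord_trans p (x : M p) i :
  cs p (pmod_trans M (2 * e%:num)%:nng p x) i = c p x i.
Proof. exact: ucoord_map. Qed.

Definition pruned_submod : submod M.
Proof.
unshelve eexists.
  move=> p; exists (fun x => forall i, c p x i != 0 -> U' i p).
  - by move=> i; rewrite ucoord0 eqxx.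
  - move=> x y Sx Sy i xyi.
    have [x0|x0] := eqVneq (c p x i) 0; last exact: Sx.
    by apply: Sy; move: xyi; rewrite ucoordD x0 add0r.
  - by move=> a x Sx i; rewrite ucoordZ mulf_eq0 => /norP[_]; exact: Sx.
by move=> p q pq x Sx i; rewrite ucoord_map => /Sx U'p; exact: upset_up U'p pq.
Defined.

(** A morphism to M(2e) can only send the [j]-th summand to summands reachable
    from [j] in one step. *)
Lemma pruned_submod_stable : prune_stable e pruned_submod.
Proof.
move=> f p x Sx.
have fxU' i : cs p (f p x) i != 0 -> U' i p.
  move=> fxi; have [j [xj _ ji]] := hom_coord_supp c fxi.
  by move=> l il; apply: (Sx j xj); exact: shift_reach_cons il.
have [y yE] : exists y : M p, forall i, c p y i = cs p (f p x) i.
  apply: (ucoord_surj c) => [|i /fxU'/(_ i)]; first exact: ucoord_fin.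
  by apply; exact: shift_reach_refl.
exists y; first by move=> i; rewrite yE; exact: fxU'.
by apply: (ucoord_eq cs) => i; rewrite ucoord_trans yE.
Qed.

(** For one step of reachability use the stability of [S] under the elementary
    morphism M -> M(2e) that sends the [l]-th summand to the [m]-th one. *)
Lemma prune_stable_reach (S : submod M) p x i j :
  prune_stable e S -> S p x -> c p x i != 0 ->
  shift_reach U (2 * e%:num) i j -> exists2 y, S p y & c p y j != 0.
Proof.
move=> Sst Sx xi; elim=> [|l m _ [y Sy yl] lm]; first by exists x.
have [z Sz fz] := Sst (elementary_hom c cs 1 l m lm) p y Sy.
exists z => //; rewrite -ucoord_trans -fz.
have -> : elementary_hom c cs 1 l m lm p y = (1 * c p y l) *: basis_vec cs m p.
  by [].
rewrite ucoordZ ucoord_basis_id ?mulr1 ?mul1r //.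
exact/lm/ucoord_supp/yl.
Qed.

Lemma prune_I_coords p (x : M p) :
  prune_I e M p x <-> forall i, c p x i != 0 -> U' i p.
Proof.
split=> [[S Sst Sx] i xi j ij|Sx].
  by have [y _] := prune_stable_reach Sst Sx xi ij; exact: ucoord_supp.
exact: (prune_I_largest pruned_submod_stable).
Qed.

(** By injectivity of M_(0 -> 2e) the zero submodule is already closed. *)
Lemma prune_K_eq0 p (x : M p) : prune_K e M p x -> x = 0.
Proof.
apply: (prune_K_smallest (K := submod_zero M)) => [q y /= ->|f q y z _ /= ->].
  exact: (subspace0 (prune_I e M q)).
rewrite linear0 => y0; apply: (ucoord_inj c) => i.
by rewrite -ucoord_trans y0 ucoord0.
Qed.

Lemma coords_pruning : inhabited (upset_coords (pruning e M)
  (fun i => upset_shift (- e%:num) (U' i))).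
Proof.
have [c'] :
    inhabited (upset_coords (pmod_subquot (prune_I e M) (prune_K e M)) U').
  apply: (coords_subquot prune_I_coords _ prune_K_eq0) => i p.
  by apply; exact: shift_reach_refl.
by constructor; exact: coords_shift.
Qed.

End PruningCoordinates.

(** * Refinements from inclusions of upsets *)

(** Barcodes contain no zero modules, so the summands with [B i] empty are
    discarded; then [A i] is empty too. *)
Lemma refinement_of_upsets P M I (A B : I -> upset R d) :
  upset_coords P A -> upset_coords M B -> (forall i p, A i p -> B i p) ->
  is_refinement P M.
Proof.
move=> cP cM AB.
pose I' := {i | exists p, B i p}.
have inc_inj : injective (@sval I (fun i => exists p, B i p)).
  move=> [i Bi] [j Bj] /= ij; case: _ / ij in Bj *.
  by rewrite (Prop_irrelevance Bi Bj).
have cM' : upset_coords M (B \o (sval : I' -> I)).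
  apply: reindex_coords cM => // j p Bjp.
  by exists (exist _ j (ex_intro _ p Bjp)).
have cP' : upset_coords P (A \o (sval : I' -> I)).
  apply: reindex_coords cP => // j p Ajp.
  by exists (exist _ j (ex_intro _ p (AB _ _ Ajp))).
exists I', (fun i => upset_pmod k (B (sval i))),
  (fun i => upset_pmod k (A (sval i))); split.
- split; last exact: iso_of_coords cM' (coords_dsum k _).
  by move=> [i [p Bip]]; exact: upset_pmod_indecomposable Bip.
- move=> [i _] /=; pose cB := coords_upset k (B i).
  have SA p q (pq : lept p q) (x : upset_pmod k (B i) p) :
    upset_space k (A i) p (val x) ->
    upset_space k (A i) q (val (pmod_map (upset_pmod k (B i)) pq x)).
    by case=> [Ap|x0]; [left; exact: upset_up Ap pq|right].
  pose S : submod (upset_pmod k (B i)) := @Submod R k d (upset_pmod k (B i))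
    (fun p => subspace_preim val (upset_space k (A i) p)) SA.
  have [cS] : inhabited (upset_coords (pmod_subquot S (submod_zero _))
      (fun _ : unit => A i)).
    apply: (coords_subquot (c := cB)) => // [p x|_ p]; last exact: AB.
    split=> [|Ax] /=.
      by case=> [//|x0 []]; rewrite /= x0 eqxx.
    have [x0|x0] := eqVneq (val x : k) 0; first by right.
    by left; exact: (Ax tt).
  exists S, (submod_zero _); split; last first.
    exact: iso_of_coords (coords_upset k _) cS.
  by move=> p x /= ->; right.
- exact: iso_of_coords cP' (coords_dsum k _).
Qed.

(** The two inclusions of the interleaving play different roles: [VU] and [UV]
    together turn a step of reachability for [V] and [t] into one for [U] and
    [e + t], and [UV] once more moves from [U j] to [V j]. *)
Lemma pruning_refinement M N I (U V : I -> upset R d) (e t : {nonneg R}) :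
  upset_coords M U -> upset_coords N V ->
  (forall i p, U i p -> V i (addpt p e%:num)) ->
  (forall i p, V i p -> U i (addpt p e%:num)) ->
  is_refinement (pruning (e%:num + t%:num)%:nng M) (pruning t N).
Proof.
move=> cM cN UV VU.
have [cPM] := coords_pruning cM (e%:num + t%:num)%:nng.
have [cPN] := coords_pruning cN t.
apply: refinement_of_upsets cPM cPN _ => i p /= Up j ij.
have -> : addpt p (- t%:num) = addpt (addpt p (- (e%:num + t%:num))) e%:num.
  rewrite /addpt -!addrA; congr (_ + _); apply/rowP => l; rewrite !mxE.
  by rewrite opprD addrAC addNr add0r.
apply/UV/Up; elim: ij => [|l m _ il lm]; first exact: shift_reach_refl.
apply: shift_reach_step il _ => q Ulq.
have -> : addpt q (2 * (e%:num + t%:num)) =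
    addpt (addpt (addpt q e%:num) (2 * t%:num)) e%:num.
  rewrite /addpt -!addrA; congr (_ + _); apply/rowP => r; rewrite !mxE.
  by rewrite mulrDr [2 * e%:num]mulr_natl mulr2n -addrA [_ + 2 * _]addrC.
exact/VU/lm/UV.
Qed.

(** * From matchings to inclusions of upsets *)

Section Interleaving.
Variables (F : pmod R k d) (U : upset R d) (e : {nonneg R}).
Hypothesis FU : pmod_iso F (upset_pmod k U).

(** The generator of [F] at [p] survives in [F] at [p + 2e] and passes through
    [G] at [p + e], which is therefore nonzero. *)
Lemma interleaved_upset_sub G (V : upset R d) p :
  pmod_iso G (upset_pmod k V) -> interleaved e F G -> U p ->
  V (addpt p e%:num).
Proof.
move=> GV [phi [psi [psiphi _]]] Up.
have [c] := coords_iso (pmod_iso_sym FU) (coords_upset k U).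
have [c'] := coords_iso (pmod_iso_sym GV) (coords_upset k V).
pose x := basis_vec c tt p.
have psix : psi (addpt p e%:num) (phi p x) <> 0.
  rewrite psiphi => x0.
  have : c p x tt = 1 := ucoord_basis_id c (i := tt) Up.
  rewrite -(ucoord_map c (lept_trans (lept_addr p e) (lept_addr _ e))) x0.
  by rewrite ucoord0 => /esym/eqP; rewrite oner_eq0.
apply: (ucoord_supp (u := c') (x := phi p x) (i := tt)).
apply/eqP => phix0; apply: psix.
have -> : phi p x = 0 by apply: (ucoord_inj c') => -[].
by rewrite linear0.
Qed.

(** The injective map F_(0 -> 2e) factors through zero. *)
Lemma interleaved_zero : interleaved e F (zero_pmod R k d) -> is_zero_pmod F.
Proof.
move=> [phi [psi [psiphi _]]] p x.
have [c] := coords_iso (pmod_iso_sym FU) (coords_upset k U).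
apply: (ucoord_inj c) => i.
rewrite -(ucoord_map c (lept_trans (lept_addr p e) (lept_addr _ e))) -psiphi.
have -> : phi p x = 0 by apply/rowP; case.
by rewrite linear0 ucoord0.
Qed.

End Interleaving.

Lemma interleaved_sym M N (e : {nonneg R}) :
  interleaved e M N -> interleaved e N M.
Proof. by move=> [phi [psi [h1 h2]]]; exists psi, phi. Qed.

Lemma barcode_upset M I (F : I -> pmod R k d) :
  upset_decomposable M -> is_barcode M F ->
  exists U : I -> upset R d, (forall i, pmod_iso (F i) (upset_pmod k (U i))) /\
    inhabited (upset_coords M U).
Proof.
move=> [J [V MV]] [Find MF].
have [c] := coords_iso (pmod_iso_sym MV) (coords_dsum k V).
have [s sP] := choice (fun i => summand_upset c MF (Find i)).
exists (V \o s); split=> //.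
apply: coords_iso (coords_dsum k _).
apply: pmod_iso_trans (pmod_iso_sym MF).
exact: pmod_iso_dsum (fun i => pmod_iso_sym (sP i)).
Qed.

(** Bars are nonzero, so [interleaved_zero] leaves none of them unmatched. *)
Lemma matching_upsets M N (e : {nonneg R}) :
  upset_decomposable M -> upset_decomposable N -> has_matching e M N ->
  exists (I : Type) (U V : I -> upset R d),
    [/\ inhabited (upset_coords M U), inhabited (upset_coords N V),
        forall i p, U i p -> V i (addpt p e%:num) &
        forall i p, V i p -> U i (addpt p e%:num)].
Proof.
move=> Mups Nups [I [J [F [G [MF NG [A [B [s [s_bij sFG A0 B0]]]]]]]]].
have [U [FU [cM]]] := barcode_upset Mups MF.
have [V [GV [cN]]] := barcode_upset Nups NG.
have AT i : i \in A.
  apply/mem_set; apply: contrapT => /A0 /(interleaved_zero (FU i)).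
  exact: (MF.1 i).1.
have BT j : j \in B.
  apply/mem_set; apply: contrapT => /B0 /(interleaved_zero (GV j)).
  exact: (NG.1 j).1.
pose f i := val (s (SigSub (AT i))).
have FGf i : interleaved e (F i) (G (f i)) by exact: (sFG (SigSub (AT i))).
exists I, U, (V \o f); split => //.
- constructor; apply: reindex_coords cN => [i j /val_inj/(bij_inj s_bij)|j p _].
    by move/(congr1 val).
  have [t sK tK] := s_bij; exists (val (t (SigSub (BT j)))).
  rewrite /f (_ : SigSub _ = t (SigSub (BT j))) ?tK //.
  exact: val_inj.
- by move=> i p; exact: (interleaved_upset_sub (FU i) (GV _) (FGf i)).
- move=> i p; apply: (interleaved_upset_sub (GV _) (FU i)).
  exact: interleaved_sym (FGf i).
Qed.

End Pruning.

Theorem theorem3p18 (R : realType) (k : fieldType) (d : nat) (hd : (0 < d)%N)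
    (M N : pmod R k d) (Mfin : pfd M) (Nfin : pfd N)
    (Mups : upset_decomposable M) (Nups : upset_decomposable N) :
  (pruning_dist M N <= bottleneck_dist M N)%E.
Proof.
apply: le_ereal_inf => _ [e eMN <-]; exists e => // t.
have [I [U [V [[cM] [cN] UV VU]]]] := matching_upsets Mups Nups eMN.
split; first exact: pruning_refinement cM cN UV VU.
exact: pruning_refinement cN cM VU UV.
Qed.
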